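(* Let $X$ be a Tychonoff space such that every finite power of $X$ is Lindelöf, and let $n\ge 1$ be an integer. Then the following statements are equivalent: (1) $C_p(X)$ is strongly sequentially separable; (2) $C_p(X^n)$ is strongly sequentially separable; (3) $(C_p(X))^{\aleph_0}$ is strongly sequentially separable; (4) $C_p(X)$ is separable and Fréchet-Urysohn; (5) $C_p(X^n)$ is separable and Fréchet-Urysohn; (6) $(C_p(X))^{\aleph_0}$ is separable and Fréchet-Urysohn; (7) $iw(X)=\aleph_0$ and $X$ satisfies projective $S_1(\Omega,\Gamma)$; (8) $iw(X)=\aleph_0$ and $X^n$ satisfies projective $S_1(\Omega,\Gamma)$; (9) $iw(X)=\aleph_0$ and $X$ satisfies $S_1(\Omega,\Gamma)$; (10) $iw(X^n)=\aleph_0$ and $X^n$ satisfies $S_1(\Omega,\Gamma)$; (11) $iw(X)=\aleph_0$ and $X$ has the $\gamma$ property; (12) $iw(X^n)=\aleph_0$ and $X^n$ has the $\gamma$ property; (13) $C_p(X,\mathbb{R}^{\aleph_0})$ is separable and Fréchet-Urysohn; (14) $C_p(X,\mathbb{R}^{\aleph_0})$ is strongly sequentially separable.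
   Context: $C_p(X)$ is the space of continuous real-valued functions on $X$ with the topology of pointwise convergence; $C_p(X,\mathbb{R}^{\aleph_0})$ is the space of continuous maps $X\to\mathbb{R}^{\aleph_0}$ with the topology of pointwise convergence. A subset $D$ of a space $Z$ is sequentially dense if every point of $Z$ is the limit of a sequence of points of $D$. $Z$ is strongly sequentially separable if $Z$ is separable and every countable dense subset of $Z$ is sequentially dense. $iw(X)$ is the smallest infinite cardinal $\tau$ such that $X$ admits a one-to-one continuous map onto a Tychonoff space of weight at most $\tau$. A cover $\mathcal{U}$ of $X$ is an $\omega$-cover if $X\notin\mathcal{U}$ and every finite subset of $X$ is contained in a member of $\mathcal{U}$; it is a $\gamma$-cover if it is infinite and each $x\in X$ belongs to all but finitely many elements of $\mathcal{U}$. $\Omega$ (resp. $\Gamma$) is the family of open $\omega$-covers (resp. open $\gamma$-covers) of the space. $S_1(\mathcal{A},\mathcal{B})$: for each sequence $(A_n:n\in\omega)$ of elements of $\mathcal{A}$ there are $b_n\in A_n$ such that $\{b_n:n\in\omega\}\in\mathcal{B}$. $X$ has the $\gamma$ property if every open $\omega$-cover of $X$ contains a sequence that is a $\gamma$-cover of $X$. $X$ satisfies projective $S_1(\Omega,\Gamma)$ if every second countable Tychonoff space that is a continuous image of $X$ has the $\gamma$ property. *)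

(* Defs.v *)
From HB Require Import structures.
From mathcomp Require Import all_boot all_order all_algebra.
From mathcomp Require Import all_classical all_reals topology.
From mathcomp Require Import normedtype.

Set Implicit Arguments.
Unset Strict Implicit.
Unset Printing Implicit Defensive.

Local Open Scope classical_set_scope.
Local Open Scope card_scope.

(* The pointwise topology is the one inherited from {ptws X -> Y}; it has to be
   put on continuousType by hand, which carries no default topology. *)
Definition Cp (X Y : topologicalType) : topologicalType :=
  initial_topology (fun f : continuousType X Y => f : {ptws X -> Y}).

Section separation.
Variable X : topologicalType.

(* By uniform_separatorP, the library's completely_regular_space is separation
   of points from closed sets by continuous real functions. *)
Definition tychonoff_space : Prop :=
  completely_regular_space X /\ accessible_space X.

Definition lindelof : Prop :=
  forall U : set (set X), U `<=` open -> \bigcup_(A in U) A = setT ->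
  exists V : set (set X),
    [/\ V `<=` U, countable V & \bigcup_(A in V) A = setT].

End separation.

Section sequential.
Variable Z : topologicalType.

Definition separable : Prop := exists2 D : set Z, countable D & dense D.

Definition sequentially_dense (D : set Z) : Prop :=
  forall z : Z, exists2 u : nat -> Z, (forall k, D (u k)) & u @ \oo --> z.

Definition strongly_sequentially_separable : Prop :=
  separable /\
  forall D : set Z, countable D -> dense D -> sequentially_dense D.

Definition frechet_urysohn : Prop :=
  forall (A : set Z) (z : Z), closure A z ->
  exists2 u : nat -> Z, (forall k, A (u k)) & u @ \oo --> z.

End sequential.

(* Cardinals are represented by sets of arbitrary type, compared by #<=. *)
Section iw.

Definition weight_le (Y : topologicalType) (I : Type) (K : set I) : Prop :=
  exists2 B : set (set Y), B #<= K & basis B.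

Definition condenses_le (X : topologicalType) (I : Type) (K : set I) : Prop :=
  exists (Y : topologicalType) (f : X -> Y),
    [/\ tychonoff_space Y, weight_le Y K, continuous f, injective f
      & range f = setT].

(* iw(X) is the cardinality of K *)
Definition iw_eq (X : topologicalType) (I : Type) (K : set I) : Prop :=
  [/\ infinite_set K, condenses_le X K
    & forall (J : Type) (L : set J),
        infinite_set L -> condenses_le X L -> K #<= L].

End iw.

Section covers.
Variable X : topologicalType.
Implicit Type U : set (set X).

Definition open_cover U : Prop := U `<=` open /\ \bigcup_(A in U) A = setT.

Definition Omega : set (set (set X)) := [set U |
  [/\ open_cover U, ~ U setT
    & forall F : set X, finite_set F -> exists2 A, U A & F `<=` A]].

Definition Gamma : set (set (set X)) := [set U |
  [/\ open_cover U, infinite_set U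
    & forall x : X, finite_set [set A | U A /\ ~ A x]]].

Definition S1 (P Q : set (set (set X))) : Prop :=
  forall A : nat -> set (set X), (forall k, P (A k)) ->
  exists2 b : nat -> set X, (forall k, A k (b k)) & Q (range b).

Definition gamma_property : Prop :=
  forall U, Omega U ->
  exists2 b : nat -> set X, (forall k, U (b k)) & Gamma (range b).

End covers.

Definition projective_S1_Omega_Gamma (X : topologicalType) : Prop :=
  forall (Y : topologicalType) (f : X -> Y),
    @second_countable Y -> tychonoff_space Y ->
    continuous f -> range f = setT -> gamma_property Y.

(* Main.v *)
Require Import Defs.
From mathcomp Require Import all_boot all_order all_algebra.
From mathcomp Require Import all_classical all_reals topology normedtype.
From mathcomp Require Import interval_inference.
From mathcomp Require Import ring lra.

(** Each of the fourteen statements is equivalent to the conjunction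
    [separating_omega_gamma] of two conditions on [X]: some sequence of
    continuous real functions separates points, and from every family of open
    sets that captures all finite sets one can extract a sequence whose terms
    eventually contain each point.

    The first condition expresses both that the i-weight is aleph_0 and that
    [Cp X R] is separable.  A separating sequence makes [X] condense onto
    [condensation g], which is second countable and Tychonoff; over such a
    space countably much data (basic open sets and rational values) suffices to
    prescribe a dense sequence of functions
    ([second_countable_dense_sequence]); and a dense sequence separates points.

    The second condition is the gamma property.  It agrees with
    S_1(Omega, Gamma): removing a point [p k] from the members of the k-th cover
    merges countably many covers into one, and a sequence that eventually
    contains each [p k] uses each of the original covers only finitely often
    ([omega_gamma_diagonal], after Gerlits and Nagy).  It passes from [X] to its
    finite powers by a tube argument ([omega_gamma_power]).

    Diagonal selection gives the Frechet-Urysohn property for every space of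
    sequences of functions: choose at step [k] from the sets where a member of
    [A] is [1/(k+1)]-close to the limit in the first [k] entries
    ([diagonal_frechet_urysohn]).

    For the converse the Lindelof powers enter: they reduce an omega-cover to
    countably many cozero sets [h k <> 0] ([omega_family_cozero]).  If the
    sequence [e] is dense in [Cp X R], then so is the countable set of all
    [1 + e j * h k], and a sequence of such functions tending to 0 selects
    cozero sets that eventually contain each point, since each function is 1 off
    its cozero set ([strongly_sequentially_separable_omega_gamma]).  Likewise
    the [h k] together with a separating sequence define one second countable
    image of [X] to which the projective property applies
    ([projective_omega_gamma]).

    Finally, strong sequential separability descends from sequences of functions
    to functions by looking at eventually constant sequences over a countable
    dense set ([sequences_strongly_sequentially_separable]). *)

Set Implicit Arguments.
Unset Strict Implicit.
Unset Printing Implicit Defensive.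

Import Order.TTheory GRing.Theory Num.Theory.
Import numFieldNormedType.Exports.
Local Open Scope classical_set_scope.

(** * Convergence and neighbourhoods read off on coordinates *)

Lemma ptws_cvg (I : choiceType) (V : topologicalType)
    (F : set_system {ptws I -> V}) (f : {ptws I -> V}) : Filter F ->
  F --> f <-> forall i, (fun g : I -> V => g i) @ F --> f i.
Proof.
move=> FF; split => [Ff i|Ff].
  exact: cvg_trans (cvg_app _ Ff) (@proj_continuous I (fun=> V) i f).
apply/cvg_sup => i A [_ [[B oB <-] Bfi] BA]; apply: (filterS BA).
by apply: (Ff i); exact: open_nbhs_nbhs.
Qed.

Lemma initial_cvg (S : choiceType) (T : topologicalType) (f : S -> T)
    (F : set_system (initial_topology f)) (s : initial_topology f) :
  Filter F -> F --> s <-> f @ F --> f s.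
Proof.
move=> FF; split => [Fs|Ff].
  exact: cvg_trans (cvg_app _ Fs) (@initial_continuous _ _ f s).
move=> A [_ [[B oB <-] Bfi] BA]; apply: (filterS BA).
by apply: Ff; exact: open_nbhs_nbhs.
Qed.

Lemma continuous_ptws (S : topologicalType) (I : choiceType)
    (V : topologicalType) (f : S -> {ptws I -> V}) :
  continuous f <-> forall i, continuous (fun s => f s i).
Proof.
split=> [cf i s|cf s]; first exact: (proj1 (ptws_cvg _ _) (cf s) i).
by apply/ptws_cvg => i; exact: cf.
Qed.

Lemma dense_closure (T : topologicalType) (A : set T) :
  dense A <-> forall z, closure A z.
Proof.
split=> [dA z B|clA O [z Oz] oO]; last first.
  by rewrite setIC; apply: (clA z); exact: open_nbhs_nbhs.
rewrite nbhsE => -[O [oO Oz] OB].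
have [|y [Oy Ay]] := dA O _ oO; first by exists z.
by exists y; split=> //; exact: OB.
Qed.

Section coordinates.
Local Open Scope ring_scope.
Variable R : realType.

(** The topology of [Z] is initial for the family [phi ^~ i].  Phrasing this
    through convergence of filters lets [Cp X R], sequences of functions,
    functions into [R^nat] and [condensation g] be handled by one theory. *)
Definition coordinates (Z : topologicalType) (I : Type) (phi : Z -> I -> R) :=
  forall (F : set_system Z) (z : Z), Filter F ->
    F --> z <-> forall i, phi ^~ i @ F --> phi z i.

Definition close_on (I : eqType) (s : seq I) (e : R) (f g : I -> R) :=
  forall i, i \in s -> `|f i - g i| < e.

Lemma ptws_coordinates (I : choiceType) : @coordinates {ptws I -> R} I id.
Proof. by move=> F z FF; exact: ptws_cvg. Qed.

Lemma Cp_coordinates (X : topologicalType) :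
  @coordinates (Cp X R) X (fun f => f).
Proof. by move=> F f FF; rewrite initial_cvg ptws_cvg. Qed.

Lemma ptws_Cp_coordinates (X : topologicalType) :
  @coordinates {ptws nat -> Cp X R} (nat * X)
    (fun f ix => (f ix.1 : continuousType X R) ix.2).
Proof.
move=> F f FF; rewrite ptws_cvg; split => [Ff [i x]|Ff i].
  by move/(@Cp_coordinates X) : (Ff i); exact.
by apply/(@Cp_coordinates X) => x; exact: (Ff (i, x)).
Qed.

Lemma Cp_ptws_coordinates (X : topologicalType) :
  @coordinates (Cp X {ptws nat -> R}) (nat * X)
    (fun f ix => (f : continuousType X {ptws nat -> R}) ix.2 ix.1).
Proof.
move=> F f FF; rewrite initial_cvg ptws_cvg; split => [Ff [i x]|Ff x].
  by move/(@ptws_coordinates nat) : (Ff x); exact.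
by apply/(@ptws_coordinates nat) => i; exact: (Ff (i, x)).
Qed.

Lemma initial_coordinates (X : choiceType) (g : nat -> X -> R) :
  @coordinates (initial_topology (fun x => g^~ x : {ptws nat -> R})) nat
    (fun x k => g k x).
Proof. by move=> F x FF; rewrite initial_cvg (@ptws_coordinates nat). Qed.

Section coordinates_theory.
Variables (Z : topologicalType) (I : eqType) (phi : Z -> I -> R).
Hypothesis phiP : @coordinates Z I phi.

Lemma near_close_on z (s : seq I) e : 0 < e ->
  \forall z' \near z, close_on s e (phi z') (phi z).
Proof.
move=> e0; elim: s => [|i s ih]; first exact: nearW.
have phi_i : phi ^~ i @ z --> phi z i.
  by apply: (phiP z (nbhs_filter z)).1; exact: cvg_id.
move/cvgrPdist_lt : phi_i => /(_ _ e0); apply: filterS2 ih => z' zs zi j.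
by rewrite in_cons => /orP[/eqP->|/zs//]; rewrite distrC.
Qed.

(** The sets on the right form a filter base, and the filter it generates tends
    to [z] in every coordinate, hence refines the neighbourhood filter. *)
Lemma coordinates_nbhs z (W : set Z) : nbhs z W <->
  exists s : seq I, exists2 e, 0 < e &
    forall z', close_on s e (phi z') (phi z) -> W z'.
Proof.
split=> [zW|[s [e e0 sW]]]; last first.
  by apply: filterS (near_close_on z s e0) => z' /sW.
pose B (se : seq I * R) := [set z' | close_on se.1 se.2 (phi z') (phi z)].
pose F := filter_from [set se : seq I * R | 0 < se.2] B.
have FF : Filter F.
  apply: filter_from_filter; first by exists ([::], 1) => /=.
  move=> [s d] [t e] /= d0 e0; exists (s ++ t, Num.min d e) => /=.
    by rewrite lt_min d0.
  move=> z' zz'; split => i /= si.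
    by apply: lt_le_trans (zz' i _) _; rewrite ?mem_cat ?si//= ge_min lexx.
  apply: lt_le_trans (zz' i _) _; rewrite ?mem_cat ?si ?orbT//=.
  by rewrite ge_min lexx orbT.
have /(_ W zW) [[s e] /= e0 sW] : F --> z.
  apply/phiP => i; apply/cvgrPdist_lt => e e0; exists ([:: i], e) => //= z'.
  by move=> /(_ i); rewrite mem_head distrC; exact.
by exists s, e.
Qed.

Lemma coordinates_closure (A : set Z) z : closure A z <->
  forall (s : seq I) e, 0 < e ->
    exists2 a, A a & close_on s e (phi a) (phi z).
Proof.
split=> [clA s e e0|clA W /coordinates_nbhs[s [e e0 sW]]].
  by have [a [Aa]] := clA _ (near_close_on z s e0); exists a.
by have [a Aa /sW] := clA s e e0; exists a.
Qed.

Lemma coordinates_dense (A : set Z) : dense A <->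
  forall z (s : seq I) e, 0 < e ->
    exists2 a, A a & close_on s e (phi a) (phi z).
Proof.
rewrite dense_closure; split=> clA z; first exact/coordinates_closure.
by apply/coordinates_closure; exact: clA.
Qed.

End coordinates_theory.

End coordinates.

(** * Countable dense and separating sequences of functions *)

Lemma countable_range (T : Type) (A : set T) :
  countable A -> A !=set0 -> exists u : nat -> T, range u = A.
Proof.
move=> cA A0; have /pfcard_geP[A_eq0|[f]] := cA.
  by move: A0; rewrite A_eq0 => -[].
exists f; rewrite eqEsubset; split=> [_ [k _ <-]|x Ax].
  exact: (@funS _ _ _ _ f).
by have [k _ <-] := @surj _ _ _ _ f _ Ax; exists k.
Qed.

Lemma second_countable_sequence (X : topologicalType) :
  @second_countable X ->
  exists2 b : nat -> set X, (forall k, open (b k)) &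
    forall x W, nbhs x W -> exists2 k, b k x & b k `<=` W.
Proof.
move=> [B cB [oB nB]].
have [/(countable_range cB)[b rb]|B0] := pselect (B !=set0).
  exists b => [k|x W /nB [A [BA Ax] AW]].
    by apply: oB; rewrite -rb; exists k.
  have [k _ bk] : range b A by rewrite rb.
  by exists k; rewrite bk.
exists (fun=> set0) => [k|x W /nB[A [BA _] _]]; first exact: open0.
by case: B0; exists A.
Qed.

Section separability.
Local Open Scope ring_scope.
Variable R : realType.

Lemma rational_approximation (r e : R) : 0 < e ->
  exists q : rat, `|r - ratr q| < e.
Proof.
move=> e0; have [q] : exists q : rat, ratr q \in `](r - e), (r + e)[.
  by apply: rat_in_itvoo; rewrite ltrBlDr -addrA ltrDl addr_gt0.
rewrite in_itv /= => /andP[q1 q2]; exists q.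
by rewrite ltr_norml; apply/andP; split; lra.
Qed.

Section tychonoff.
Variable X : topologicalType.
Hypothesis Xtych : tychonoff_space X.

(** Multiply the separating functions of the individual points. *)
Lemma tychonoff_finite_separation (s : seq X) (U : set X) :
  open U -> [set` s] `<=` U ->
  exists u : X -> R, [/\ continuous u, forall x, 0 <= u x <= 1,
    forall x, x \in s -> u x = 0 & forall x, ~ U x -> u x = 1].
Proof.
move=> oU; elim: s => [_|a s ih sU].
  by exists (cst 1); split => // [x|x]; [exact: cvg_cst|rewrite ler01 lexx].
have [|u [cu u01 us uU]] := ih.
  by move=> x /= xs; apply: sU; rewrite /= in_cons xs orbT.
have /(@uniform_separatorP _ R)[w [cw w01 wa wU]] :
    uniform_separator [set a] (~` U).
  apply: Xtych.1; first exact: open_closedC.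
  by apply; apply: sU; rewrite /= mem_head.
exists (fun x => w x * u x); split.
- by move=> x; apply: cvgM; [exact: cw|exact: cu].
- move=> x; have /andP[u0 u1] := u01 x.
  have : `[0, 1]%classic (w x) by apply: w01; exists x.
  rewrite /= in_itv /= => /andP[w0 w1].
  by rewrite mulr_ge0//= mulr_ile1.
- move=> x; rewrite in_cons => /orP[/eqP ->|/us ->]; last by rewrite mulr0.
  by rewrite (_ : w a = 0) ?mul0r//; apply: wa; exists a.
- by move=> x Ux; rewrite uU// (_ : w x = 1) ?mulr1//; apply: wU; exists x.
Qed.

(** Correct the values one point at a time by adding a multiple of a function
    that vanishes at the points already treated. *)
Lemma tychonoff_interpolation (s : seq X) (v : X -> R) :
  exists2 f : X -> R, continuous f & forall x, x \in s -> f x = v x.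
Proof.
elim: s => [|a s [f cf fs]]; first by exists (cst 0) => // x; exact: cvg_cst.
have [as_|as_] := boolP (a \in s).
  by exists f => // x; rewrite in_cons => /orP[/eqP->|]; exact: fs.
have [||u [cu _ ua us]] := @tychonoff_finite_separation [:: a] (~` [set` s]).
- rewrite openC; apply: (proj1 accessible_finite_set_closed Xtych.2).
  exact: finite_seq.
- by move=> x /=; rewrite inE => /eqP ->; exact/negP.
exists (fun x => f x + (v a - f a) * (1 - u x)).
  move=> x; apply: cvgD; first exact: cf.
  by apply: cvgM; [exact: cvg_cst|apply: cvgB; [exact: cvg_cst|exact: cu]].
move=> x; rewrite in_cons => /orP[/eqP ->|xs].
  by rewrite ua ?mem_head// subr0 mulr1 addrC subrK.
by rewrite us ?subrr ?mulr0 ?addr0 ?fs//= => /(_ xs).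
Qed.

End tychonoff.

(** In a Tychonoff space this is density of the range in [Cp X R]: by
    interpolation, arbitrary functions may replace continuous ones as
    targets. *)
Definition dense_sequence (X : topologicalType) (e : nat -> X -> R) :=
  (forall k, continuous (e k)) /\
  forall v (s : seq X) eps, 0 < eps -> exists k, close_on s eps (e k) v.

Definition separating_sequence (X : topologicalType) (g : nat -> X -> R) :=
  (forall k, continuous (g k)) /\
  forall x y, (forall k, g k x = g k y) -> x = y.

Lemma dense_sequence_of_countType (X : topologicalType) (J : countType)
    (e : J -> X -> R) : (forall j, continuous (e j)) ->
  (forall v (s : seq X) eps, 0 < eps -> exists j, close_on s eps (e j) v) ->
  exists e' : nat -> X -> R, dense_sequence e'.
Proof.
move=> ce de; exists (fun n => if unpickle n is Some j then e j else cst 0).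
split=> [n|v s eps eps0].
  by case: unpickle => [j|]; [exact: ce|move=> x; exact: cvg_cst].
by have [j ej] := de v s _ eps0; exists (pickle j); rewrite pickleK.
Qed.

(** A function is determined up to [eps] on a finite set by finitely many pairs
    (basic open set, rational value) and a rational precision; the sequence
    picks one function for each such datum that some function realizes. *)
Lemma second_countable_dense_sequence (X : topologicalType) :
  tychonoff_space X -> @second_countable X ->
  exists e : nat -> X -> R, dense_sequence e.
Proof.
move=> Xtych /second_countable_sequence[b ob nb].
pose P (j : seq (nat * rat) * rat) (f : X -> R) := continuous f /\
  forall iq, iq \in j.1 -> forall y, b iq.1 y -> `|f y - ratr iq.2| < ratr j.2.
pose e j : X -> R := if pselect (exists f, P j f) is left w
  then projT1 (cid w) else cst 0.
have eP j f : P j f -> P j (e j).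
  rewrite /e; case: pselect => [w _|n Pf]; first exact: projT2 (cid w).
  by case: n; exists f.
apply: (@dense_sequence_of_countType _ _ e) => [j|v s eps eps0].
  rewrite /e; case: pselect => [w|n x]; last exact: cvg_cst.
  by case: (cid w) => f [].
have [f cf fv] := tychonoff_interpolation Xtych s v.
have [r] : exists r : rat, ratr r \in `]0, (eps / 2)[.
  by apply: rat_in_itvoo; rewrite divr_gt0.
rewrite in_itv /= => /andP[r0 reps].
have /choice[q qP] y : exists q : nat * rat,
    [/\ b q.1 y, `|f y - ratr q.2| < ratr r &
        forall z, b q.1 z -> `|f z - ratr q.2| < ratr r].
  have [q fyq] := rational_approximation (f y) r0.
  have [|k bky bkW] := nb y [set z | `|f z - ratr q| < ratr r].
    have : (fun z => `|f z - ratr q|) @ y --> `|f y - ratr q|.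
      by apply: cvg_norm; apply: cvgB; [exact: cf|exact: cvg_cst].
    by move/cvgr_lt; exact.
  by exists (k, q).
pose j := ([seq q y | y <- s], r).
exists j => y ys.
have [_ /(_ (q y))] : P j (e j).
  apply: (eP j f); split=> // _ /mapP[z zs ->] w.
  by have [_ _] := qP z; exact.
have [bqy fq _] := qP y.
move=> /(_ (map_f q ys) y bqy) /=; rewrite -fv// => eq.
rewrite (_ : _ - _ = (e j y - ratr (q y).2) - (f y - ratr (q y).2)); last lra.
apply: le_lt_trans (ler_normB _ _) _.
by rewrite [eps]splitr ltrD ?(lt_trans _ reps).
Qed.

Lemma dense_sequence_separating (X : topologicalType) (e : nat -> X -> R) :
  dense_sequence e -> separating_sequence e.
Proof.
move=> [ce de]; split=> // x y exy; apply/eqP; apply: contraT => xy.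
have [k ek] := de (fun z => (z == y)%:R) [:: x; y] (1 / 2) ltac:(lra).
have := ek x; have := ek y; rewrite !inE !eqxx orbT (negbTE xy) exy.
move=> /(_ isT) /= ; rewrite ltr_norml => ey /(_ isT).
by rewrite /= subr0 ltr_norml => ex; exfalso; move: ex ey; lra.
Qed.

(** The coarser topology is put on [X] itself, so that condensing is the
    identity and no subspace of [R^nat] has to be formed. *)
Definition condensation (X : choiceType) (g : nat -> X -> R) :
    topologicalType :=
  initial_topology (fun x => g^~ x : {ptws nat -> R}).

Lemma condensation_continuous (X : topologicalType) (g : nat -> X -> R) :
  (forall k, continuous (g k)) -> continuous (idfun : X -> condensation g).
Proof.
move=> cg x; apply/(@initial_coordinates R X g) => k; exact: cg.
Qed.

Lemma continuous_on_condensation (X : choiceType) (g : nat -> X -> R) k :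
  continuous (g k : condensation g -> R).
Proof.
by move=> x; exact: (@initial_coordinates R X g _ x (nbhs_filter x)).1 cvg_id _.
Qed.

Lemma condensation_second_countable (X : choiceType) (g : nat -> X -> R) :
  @second_countable (condensation g).
Proof.
pose B (l : seq (nat * rat * rat)) : set (condensation g) :=
  [set x | forall t, t \in l -> `|g t.1.1 x - ratr t.1.2| < ratr t.2].
exists (range B); first exact: (sub_countable (card_image_le _ _)).
split=> [_ [l _ <-]|x W].
  elim: l => [|t l ih].
    have -> : B [::] = setT by rewrite eqEsubset; split=> x _ // t.
    exact: openT.
  have -> : B (t :: l) =
      g t.1.1 @^-1` [set r | `|r - ratr t.1.2| < ratr t.2] `&` B l.
    rewrite eqEsubset; split=> x.
      move=> xt; split; first by apply: xt; rewrite mem_head.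
      by move=> t' l'; apply: xt; rewrite in_cons l' orbT.
    by move=> [/= xt xl] t'; rewrite in_cons => /orP[/eqP->|/xl].
  apply: openI => //; apply: open_comp.
    by move=> x _; exact: continuous_on_condensation.
  apply: (open_comp _ (@open_lt _ (ratr t.2))) => r _; apply: cvg_norm.
  by apply: cvgB; [exact: cvg_id|exact: cvg_cst].
move=> /(coordinates_nbhs (@initial_coordinates R X g))[s [eps eps0 sW]].
have [r] : exists r : rat, ratr r \in `]0, (eps / 2)[.
  by apply: rat_in_itvoo; rewrite divr_gt0.
rewrite in_itv /= => /andP[r0 reps].
have /choice[q qP] k := rational_approximation (g k x) r0.
exists (B [seq (k, q k, r) | k <- s]).
  split; first by exists [seq (k, q k, r) | k <- s].
  by move=> _ /mapP[k ks ->] /=.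
move=> y yB; apply: sW => k ks.
have := yB _ (map_f (fun k => (k, q k, r)) ks) => /= yq.
rewrite (_ : _ - _ = (g k y - ratr (q k)) - (g k x - ratr (q k))); last lra.
apply: le_lt_trans (ler_normB _ _) _.
by rewrite [eps]splitr ltrD ?(lt_trans _ reps).
Qed.

Lemma condensation_tychonoff (X : topologicalType) (g : nat -> X -> R) :
  separating_sequence g -> tychonoff_space (condensation g).
Proof.
move=> [cg gI]; split; first exact: (@uniform_completely_regular R).
move=> x y xy; have [k gk] : exists k, g k x <> g k y.
  by apply/existsNP => gxy; move/eqP : xy; apply; exact: gI.
exists (g k @^-1` (~` [set g k y])); split.
- apply: open_comp; first by move=> z _; exact: continuous_on_condensation.
  by rewrite openC; exact: closed_eq.
- by rewrite inE.
- by rewrite inE /= => /(_ erefl).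
Qed.

Lemma separating_sequence_dense (X : topologicalType) (g : nat -> X -> R) :
  separating_sequence g -> exists e : nat -> X -> R, dense_sequence e.
Proof.
move=> gS; have [e [ce de]] := second_countable_dense_sequence
  (condensation_tychonoff gS) (condensation_second_countable g).
exists e; split=> // k x.
exact: (cvg_comp _ _ (condensation_continuous gS.1 (x:=x)) (ce k x)).
Qed.

(** Since [iw_eq] compares with infinite sets only, minimality of aleph_0 is
    automatic and the content is the existence of the condensation. *)
Lemma separating_sequence_iw (X : topologicalType) :
  (exists g : nat -> X -> R, separating_sequence g) <-> iw_eq X [set: nat].
Proof.
split=> [[g gS]|[_ [Y [f [Ytych [B cB bB] cf fI _]]] _]].
  split; [exact: infinite_nat| |by move=> J L /infiniteP].
  exists (condensation g), idfun; split => //.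
  - exact: condensation_tychonoff.
  - exact: condensation_second_countable.
  - exact: condensation_continuous gS.1.
  - by rewrite image_id.
have [|e /dense_sequence_separating[ce eI]] :=
  @second_countable_dense_sequence Y Ytych; first by exists B.
exists (fun k => e k \o f); split=> [k x|x y exy]; last exact/fI/eI.
by apply: continuous_comp; [exact: cf|exact: ce].
Qed.

Lemma dense_sequence_Cp (X : topologicalType) : tychonoff_space X ->
  (exists e : nat -> X -> R, dense_sequence e) <-> separable (Cp X R).
Proof.
move=> Xtych; have CpP := @Cp_coordinates R X.
split=> [[e [ce de]]|[D cD /(coordinates_dense CpP) dD]].
  exists (range (fun k => mkcts (ce k) : Cp X R)).
    exact: (sub_countable (card_image_le _ _)).
  apply/(coordinates_dense (@Cp_coordinates R X)) => f s eps eps0.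
  have [k ek] := de (f : continuousType X R) s eps eps0.
  by exists (mkcts (ce k) : Cp X R); [exists k|].
have [|e eD] := countable_range cD.
  by have [f Df _] := dD (cst 0 : continuousType X R) [::] 1 ltr01; exists f.
exists (fun k => (e k : continuousType X R) : X -> R).
split=> [k|v s eps eps0]; first exact: cts_fun.
have [f cf fv] := tychonoff_interpolation Xtych s v.
have [d Dd dv] := dD (mkcts cf : Cp X R) s eps eps0.
have [k _ ek] : range e d by rewrite eD.
by exists k => x xs; rewrite ek -fv//; exact: dv.
Qed.

End separability.

(** * Selection from omega-covers *)

(** An open omega-cover, except that [X] itself may be a member: in this form
    the notion is stable under preimages and under pairwise intersection, and it
    covers the families that arise from a uniformly close function. *)
Definition omega_family (X : topologicalType) (U : set (set X)) :=
  U `<=` open /\ forall s : seq X, exists2 A, U A & [set` s] `<=` A.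

Definition eventually_covers (X : Type) (b : nat -> set X) :=
  forall x, \forall k \near \oo, b k x.

Definition omega_gamma (X : topologicalType) :=
  forall U : set (set X), omega_family U ->
  exists2 b : nat -> set X, (forall k, U (b k)) & eventually_covers b.

Definition diagonal_omega_gamma (X : topologicalType) :=
  forall U : nat -> set (set X), (forall k, omega_family (U k)) ->
  exists2 b : nat -> set X, (forall k, U k (b k)) & eventually_covers b.

Section selection.
Variable X : topologicalType.
Implicit Types (U : set (set X)) (b : nat -> set X).

Lemma omega_familyP U : Omega U <-> omega_family U /\ ~ U setT.
Proof.
split=> [[[oU _] UT Uf]|[[oU Uf] UT]].
  by split=> //; split=> // s; apply: Uf; exact: finite_seq.
split=> //; last by move=> F /finite_seqP[s ->].
split=> //; rewrite eqEsubset; split=> // x _.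
by have [A UA sA] := Uf [:: x]; exists A => //; apply: sA; exact: mem_head.
Qed.

(** The range is infinite: otherwise choose a point outside each of its members;
    all these points lie in [b N] for some [N], although one of them was chosen
    outside [b N]. *)
Lemma eventually_covers_Gamma b : (forall k, open (b k)) ->
  (forall k, b k <> setT) -> eventually_covers b -> Gamma (range b).
Proof.
move=> ob bT bX; split.
- split=> [_ [k _ <-]//|]; rewrite eqEsubset; split=> // x _.
  have [N _ bN] := bX x; exists (b N); first by exists N.
  exact: bN (leqnn N).
- move=> fb.
  have [y yb] : exists y : set X -> X, forall A, range b A -> ~ A (y A).
    have /choice[y yP] : forall A, exists y, range b A -> ~ A y.
      move=> A; have [[k _ <-]|nA] := pselect (range b A).
        have /existsNP[y by_] : ~ forall y, b k y.
          by move=> bk; apply: (bT k); rewrite eqEsubset; split.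
        by exists y.
      have /existsNP[y _] : ~ forall y, b 0%N y.
        by move=> bk; apply: (bT 0%N); rewrite eqEsubset; split.
      by exists y.
    by exists y.
  have /finite_seqP[s rb] := fb.
  have : \forall k \near \oo, forall A, A \in s -> b k (y A).
    elim: s {rb} => [|A s ih]; first exact: nearW.
    apply: filterS2 ih (bX (y A)) => k bs bA B.
    by rewrite in_cons => /orP[/eqP->|/bs].
  move=> [N _ /(_ N (leqnn N))] /(_ (b N)) bNN.
  have rbN : range b (b N) by exists N.
  by apply: (yb _ rbN); apply: bNN; move: rbN; rewrite rb.
- move=> x; have [N _ bN] := bX x.
  apply: (@sub_finite_set _ _ (b @` `I_N)); last first.
    apply: finite_image; exact: finite_II.
  move=> _ [[k _ <-] nbk]; exists k => //=.
  by rewrite ltnNge; apply/negP => Nk; exact/nbk/bN.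
Qed.

(** [b] itself may repeat a set infinitely often, so an injective enumeration
    of its range is needed. *)
Lemma Gamma_eventually_covers b : Gamma (range b) ->
  exists2 c, (forall k, range b (c k)) & eventually_covers c.
Proof.
move=> [_ /infiniteP/pcard_leP/injfunPex[c cb cI] fb].
exists c => [k|x]; first exact: cb.
have : finite_set (c @^-1` [set A | range b A /\ ~ A x]).
  apply: finite_preimage; last exact: fb.
  by move=> i j _ _; apply: cI; rewrite inE.
move=> /finite_seqP[s sE].
have : \forall k \near \oo, k \notin s.
  elim: s {sE} => [|a s ih]; first exact: nearW.
  by apply: filterS2 ih (nbhs_infty_gt a) => k ks ak; rewrite in_cons gtn_eqF.
apply: filterS => k /negP; apply: contra_notP => nck.
have : (c @^-1` [set A | range b A /\ ~ A x]) k by split=> //; exact: cb.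
by rewrite sE.
Qed.

End selection.

Lemma gamma_property_omega_gamma (X : topologicalType) :
  gamma_property X -> omega_gamma X.
Proof.
move=> gX U oU; have [UT|UT] := pselect (U setT).
  by exists (fun=> setT) => // x; exact: nearW.
have [|b Ub /Gamma_eventually_covers[c bc cX]] := gX U.
  exact/omega_familyP.
by exists c => // k; have [j _ <-] := bc k.
Qed.

Lemma S1_gamma_property (X : topologicalType) :
  S1 (@Omega X) (@Gamma X) -> gamma_property X.
Proof. by move=> SX U oU; exact: (SX (fun=> U)). Qed.

Lemma diagonal_omega_gamma_S1 (X : topologicalType) :
  diagonal_omega_gamma X -> S1 (@Omega X) (@Gamma X).
Proof.
move=> dX U oU; have [|b Ub bX] := dX U.
  by move=> k; have [] := (omega_familyP (U k)).1 (oU k).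
exists b => //; apply: eventually_covers_Gamma => // k.
  by have [[+ _] _ _] := oU k; apply.
by move=> bT; have [_ + _] := oU k; rewrite -bT.
Qed.

(** Removing [p k] from the members of the k-th cover [W k] (for distinct points
    [p k]) gives a single omega-family; a sequence extracted from it eventually
    contains each [p k], so its index in the covers [W] tends to infinity.  As
    [W] successively refines [U], a term of index at least [m] lies in a member
    of [U m]. *)
Lemma omega_gamma_diagonal (X : topologicalType) : accessible_space X ->
  omega_gamma X -> diagonal_omega_gamma X.
Proof.
move=> T1 gX U oU.
have [/finite_seqP[s sX]|/infiniteP/card_leP[f]] :=
  pselect (finite_set [set: X]).
  have /choice[b bP] k : exists A, U k A /\ [set` s] `<=` A.
    by have [A] := (oU k).2 s; exists A.
  exists b => [k|x]; first by have [] := bP k.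
  by apply: nearW => k; apply: (bP k).2; rewrite -sX.
pose p k : X := val (f (to_setT k)).
have pI i j : p i = p j -> i = j.
  by move=> /val_inj/(@inj _ _ _ f); rewrite !inE => /(_ I I)[].
(* the covers [W k] refine all of [U 0], ..., [U k] *)
have /choice[W WP] : forall k, exists W : set (set X), omega_family W /\
    forall A, W A -> forall j, (j <= k)%N -> exists2 B, U j B & A `<=` B.
  elim=> [|k [W [[oW Wf] WU]]].
    exists (U 0%N); split=> // A UA j; rewrite leqn0 => /eqP ->.
    by exists A.
  exists [set A `&` B | A in W & B in U k.+1]; split.
    split=> [_ [A WA [B UB <-]]|s].
      by apply: openI; [exact: oW|exact: ((oU k.+1).1 _ UB)].
    have [A WA sA] := Wf s; have [B UB sB] := (oU k.+1).2 s.
    exists (A `&` B); first by exists A => //; exists B.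
    by move=> x xs; split; [exact: sA|exact: sB].
  move=> _ [A WA [B UB <-]] j; rewrite leq_eqVlt => /orP[/eqP ->|jk].
    by exists B => // x [].
  by have [C UC AC] := WU A WA j jk; exists C => // x [/AC].
pose V := [set B | exists k, exists2 A, W k A & B = A `\ p k].
have [|v Vv vX] := gX V.
  split=> [_ [k [A WA ->]]|s].
    apply: openI; first exact: (WP k).1.1 _ WA.
    by rewrite openC; exact: accessible_closed_set1.
  have [k kP] : exists k, p k \notin s.
    apply: contrapT => nk; apply: infinite_nat.
    have : finite_set (p @^-1` [set` s]).
      apply: finite_preimage; last exact: finite_seq.
      by move=> i j _ _; exact: pI.
    apply: sub_finite_set => k _ /=; apply: contrapT => pks; apply: nk.
    by exists k; exact/negP.
  have [A WA sA] := (WP k).1.2 s.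
  exists (A `\ p k); first by exists k, A.
  by move=> x /= xs; split; [exact: sA|move=> xp; rewrite -xp xs in kP].
have /choice[r rP] := Vv.
(* a term of index [k] omits [p k], so each index occurs finitely often *)
have r_oo m : \forall i \near \oo, (m <= r i)%N.
  have : \forall i \near \oo, forall k, (k < m)%N -> v i (p k).
    elim: m => [|m ih]; first exact: nearW.
    apply: filterS2 ih (vX (p m)) => i vi vm k.
    by rewrite ltnS leq_eqVlt => /orP[/eqP->|/vi].
  apply: filterS => i vi; rewrite leqNgt; apply/negP => /vi.
  by have [A _ ->] := rP i; move=> [_ /=]; exact.
have /choice[i iP] m : exists i, (m <= i)%N /\ (m <= r i)%N.
  have [N _ NP] := filterI (r_oo m) (nbhs_infty_ge m).
  by exists N; have [] := NP N (leqnn N).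
have /choice[b bP] m : exists B, U m B /\ v (i m) `<=` B.
  have [A WA vA] := rP (i m).
  have [B UB AB] := (WP _).2 A WA m (iP m).2.
  by exists B; split=> //; rewrite vA => x [/AB].
exists b => [m|x]; first by have [] := bP m.
have [N _ NP] := vX x; exists N => // m /= Nm.
by apply: (bP m).2; apply: NP => /=; exact: leq_trans Nm (iP m).1.
Qed.

Lemma omega_gamma_property (X : topologicalType) :
  omega_gamma X -> gamma_property X.
Proof.
move=> gX U /omega_familyP[oU UT]; have [b Ub bX] := gX U oU.
exists b => //; apply: eventually_covers_Gamma => // k; first exact: oU.1.
by move=> bT; apply: UT; rewrite -bT.
Qed.

Lemma omega_gamma_image (X Y : topologicalType) (f : X -> Y) :
  continuous f -> range f = setT -> omega_gamma X -> omega_gamma Y.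
Proof.
move=> cf fT gX U [oU Uf].
have [|b Ub bX] := gX [set f @^-1` A | A in U].
  split=> [_ [A UA <-]|s].
    by apply: open_comp; [move=> x _; exact: cf|exact: oU].
  have [A UA sA] := Uf (map f s); exists (f @^-1` A); first by exists A.
  by move=> x xs; apply: sA; exact: map_f.
have /choice[c cP] k : exists A, U A /\ f @^-1` A = b k.
  by have [A UA fA] := Ub k; exists A.
exists c => [k|y]; first by have [] := cP k.
have [x _ <-] : range f y by rewrite fT.
by apply: filterS (bX x) => k; rewrite -(cP k).2.
Qed.

Section powers.
Variables (X : topologicalType) (n : nat).

Lemma open_cube (A : set X) : open A ->
  open [set u : {ptws 'I_n -> X} | forall i, A (u i)].
Proof.
move=> oA; rewrite openE => u Au.
suff : \forall v \near u, forall i, A (v i) by [].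
apply: (filter_forall (nbhs_filter u)) => i.
have := open_nbhs_nbhs (conj oA (Au i)).
exact: ((ptws_cvg u (nbhs_filter u)).1 cvg_id i).
Qed.

Lemma ptws_nbhs_box (u : {ptws 'I_n -> X}) (B : set {ptws 'I_n -> X}) :
  nbhs u B -> exists2 A : 'I_n -> set X, forall i, open_nbhs (u i) (A i) &
    forall w : {ptws 'I_n -> X}, (forall i, A i (w i)) -> B w.
Proof.
pose box (A : 'I_n -> set X) :=
  [set w : {ptws 'I_n -> X} | forall i, A i (w i)].
pose F := filter_from [set A | forall i, open_nbhs (u i) (A i)] box.
have FF : Filter F.
  apply: filter_from_filter.
    by exists (fun=> setT) => i; split=> //; exact: openT.
  move=> A A' uA uA'; exists (fun i => A i `&` A' i).
    by move=> i; exact: open_nbhsI.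
  by move=> w wA; split=> i; have [] := wA i.
suff /[apply] : F --> u by move=> [A uA AB]; exists A.
apply/ptws_cvg => i A; rewrite nbhsE => -[O uO OA].
exists (fun j => if j == i then O else setT) => [j|w /(_ i)].
  by case: eqP => [->//|_]; split=> //; exact: openT.
by rewrite eqxx => /OA.
Qed.

Lemma finite_box (s : seq X) : exists t : seq {ptws 'I_n -> X},
  forall u : {ptws 'I_n -> X}, u \in t <-> forall i, u i \in s.
Proof.
pose J := {ffun 'I_n -> seq_sub s}.
exists (map (fun w : J => (fun i => val (w i)) : {ptws 'I_n -> X}) (enum J)).
move=> u; split=> [/mapP[w _ ->] i|us]; first exact: valP.
apply/mapP; exists [ffun i => SeqSub (us i)]; first by rewrite mem_enum.
by apply/funext => i; rewrite ffunE.
Qed.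

(** The open sets whose cube lies in a member of [U] form an omega-family of
    [X].  Given [s], some member [B] of [U] contains the finite cube over [s],
    hence a box around each of its vertices [u].  Shrinking the neighbourhood of
    each [x] in [s] to all sides [box u i] with [u i = x] gives an open set
    containing [s] whose cube is covered by these boxes. *)
Lemma omega_gamma_power : omega_gamma X -> omega_gamma {ptws 'I_n -> X}.
Proof.
move=> gX U [oU Uf].
pose cube (A : set X) := [set u : {ptws 'I_n -> X} | forall i, A (u i)].
have [|b bU bX] := gX [set A | open A /\ exists2 B, U B & cube A `<=` B].
  split=> [A []//|s]; have [t tP] := finite_box s.
  have [B UB tB] := Uf t.
  have /choice[box boxP] (u : {ptws 'I_n -> X}) :
      exists A : 'I_n -> set X, u \in t ->
      (forall i, open_nbhs (u i) (A i)) /\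
      forall w : {ptws 'I_n -> X}, (forall i, A i (w i)) -> B w.
    have [ut|nut] := boolP (u \in t); last by exists (fun=> setT).
    have [|A uA AB] := @ptws_nbhs_box u B.
      by apply: open_nbhs_nbhs; split; [exact: oU|exact: tB].
    by exists A.
  exists [set y | exists2 x, x \in s &
      forall u, u \in t -> forall i, u i = x -> box u i y].
    split.
      rewrite openE => y [x xs xy].
      have : \forall z \near y, forall u, u \in t ->
          forall i, u i = x -> box u i z.
        have : forall u, u \in t -> forall i, u i = x -> nbhs y (box u i).
          move=> u ut i ux; apply: open_nbhs_nbhs; split; last exact: xy.
          exact: ((boxP u ut).1 i).1.
        elim: (t) => [|u t' ih] uy; first exact: nearW.
        have ih' := ih (fun u' u't => uy u' (mem_behead (s:=u::t') u't)).
        have hu : \forall z \near y, forall i, u i = x -> box u i z.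
          apply: filter_forall => i.
          have [ux|ux] := pselect (u i = x); last by apply: nearW => z /ux.
          by apply: filterS (uy u (mem_head _ _) i ux) => z uz _.
        apply: filterS2 ih' hu => z tz uz u'.
        by rewrite in_cons => /orP[/eqP->|/tz].
      by apply: filterS => z tz; exists x.
    exists B => // w wA.
    have /choice[u uP] i : exists x, x \in s /\
        forall u, u \in t -> forall j, u j = x -> box u j (w i).
      by have [x xs xw] := wA i; exists x.
    have ut : (u : {ptws 'I_n -> X}) \in t by apply/tP => i; exact: (uP i).1.
    by apply: (boxP u ut).2 => i; apply: (uP i).2.
  move=> x /= xs; exists x => // u ut i <-.
  exact: ((boxP u ut).1 i).2.
have /choice[c cP] k : exists B, U B /\ cube (b k) `<=` B.
  by have [_ [B UB bB]] := bU k; exists B.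
exists c => [k|u]; first by have [] := cP k.
have : \forall k \near \oo, forall i, b k (u i).
  by apply: filter_forall => i; exact: bX.
by apply: filterS => k bu; apply: (cP k).2.
Qed.

Lemma omega_gamma_of_power : (0 < n)%N ->
  omega_gamma {ptws 'I_n -> X} -> omega_gamma X.
Proof.
move=> n0.
apply: (@omega_gamma_image {ptws 'I_n -> X} X (fun u => u (Ordinal n0))).
  exact: (@proj_continuous _ (fun=> X)).
by rewrite eqEsubset; split=> // x _; exists (fun=> x).
Qed.

End powers.

(** * Lindelof powers *)

Definition lindelof_powers (X : topologicalType) :=
  forall m, (0 < m)%N -> lindelof {ptws 'I_m -> X}.

Lemma lindelof_image (X Y : topologicalType) (f : X -> Y) :
  continuous f -> range f = setT -> lindelof X -> lindelof Y.
Proof.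
move=> cf fT lX U oU UT.
have [||V [VU cV VT]] := lX [set f @^-1` A | A in U].
- by move=> _ [A UA <-]; apply: open_comp; [move=> x _; exact: cf|exact: oU].
- rewrite eqEsubset; split=> // x _.
  have : (\bigcup_(A in U) A) (f x) by rewrite UT.
  by move=> [A UA Afx]; exists (f @^-1` A) => //; exists A.
have /choice[c cP] B : exists A, V B -> U A /\ f @^-1` A = B.
  have [/VU[A UA fA]|nVB] := pselect (V B); first by exists A.
  by exists setT.
exists (c @` V); split; first by move=> _ [B VB <-]; exact: (cP B VB).1.
  exact: sub_countable (card_image_le _ _) cV.
rewrite eqEsubset; split=> // y _.
have [x _ <-] : range f y by rewrite fT.
have : (\bigcup_(A in V) A) x by rewrite VT.
move=> [B VB Bx]; exists (c B); first by exists B.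
by move: Bx; rewrite -{1}(cP B VB).2.
Qed.

(** [X^(mn)] maps continuously onto [(X^n)^m]. *)
Lemma lindelof_powers_power (X : topologicalType) n : (0 < n)%N ->
  lindelof_powers X -> lindelof_powers {ptws 'I_n -> X}.
Proof.
move=> n0 lX m m0; have mn0 : (0 < m * n)%N by rewrite muln_gt0 m0.
apply: (@lindelof_image {ptws 'I_(m * n) -> X} {ptws 'I_m -> {ptws 'I_n -> X}}
    (fun u i j => u (mxvec_index i j))); last exact: lX.
  apply/continuous_ptws => i; apply/continuous_ptws => j.
  exact: (@proj_continuous _ (fun=> X)).
rewrite eqEsubset; split=> // v _.
have /choice[u uP] (k : 'I_(m * n)) : exists x, forall i j,
    k = mxvec_index i j -> v i j = x.
  case/mxvec_indexP : k => i j; exists (v i j) => i' j'.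
  move=> /(f_equal (enum_val \o cast_ord (esym (mxvec_cast m n)))).
  by rewrite /= /mxvec_index !cast_ordK !enum_rankK => -[-> ->].
by exists u => //; apply/funext => i; apply/funext => j; rewrite -(uP _ i j).
Qed.

(** Complete regularity is uniformizability, and uniformities have products. *)
Lemma tychonoff_power (R : realType) (X : topologicalType) n :
  tychonoff_space X -> tychonoff_space {ptws 'I_n -> X}.
Proof.
move=> [cX T1]; split.
  exact: (@uniform_completely_regular R
    {ptws 'I_n -> @completely_regular_uniformity.type R X cX}).
move=> u v uv; have [i uvi] : exists i, u i != v i.
  apply/existsP; apply: contraNT uv; rewrite negb_exists => /forallP uv.
  by apply/eqP/funext => i; have := uv i; rewrite negbK => /eqP.
have [A [oA uA vA]] := T1 _ _ uvi.
exists (proj i @^-1` A); split; rewrite ?inE//=.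
- apply: open_comp => // w _; exact: (@proj_continuous _ (fun=> X)).
- exact/set_mem.
- by move: vA; rewrite inE.
Qed.

(** The cubes of the members of an omega-family cover every finite power, so
    countably many members suffice for the finite sets of each given size. *)
Lemma omega_family_countable (X : topologicalType) (U : set (set X)) :
  lindelof_powers X -> omega_family U ->
  exists v : nat -> set X, (forall k, U (v k)) /\
    forall s : seq X, exists k, [set` s] `<=` v k.
Proof.
move=> lX [oU Uf].
have [A0 UA0 _] := Uf [::].
have /choice[V VP] m : exists V : set (set X), [/\ V `<=` U, countable V &
    forall u : {ptws 'I_m.+1 -> X}, exists2 A, V A & forall i, A (u i)].
  pose cube (A : set X) := [set u : {ptws 'I_m.+1 -> X} | forall i, A (u i)].
  have [||W [WU cW WT]] := lX m.+1 isT (cube @` U).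
  - by move=> _ [A UA <-]; exact/open_cube/oU.
  - rewrite eqEsubset; split=> // u _.
    have [A UA sA] := Uf [seq u i | i <- enum 'I_m.+1].
    exists (cube A); first by exists A.
    by move=> i; apply: sA; apply/mapP; exists i; rewrite ?mem_enum.
  have /choice[c cP] B : exists A, W B -> U A /\ cube A = B.
    have [/WU[A UA fA]|nWB] := pselect (W B); first by exists A.
    by exists setT.
  exists (c @` W); split; first by move=> _ [B WB <-]; exact: (cP B WB).1.
    exact: sub_countable (card_image_le _ _) cW.
  move=> u; have : (\bigcup_(A in W) A) u by rewrite WT.
  move=> [B WB Bu]; exists (c B); first by exists B.
  by move: Bu; rewrite -{1}(cP B WB).2.
have cV : countable (\bigcup_m V m).
  by apply: bigcup_countable => // m _; have [] := VP m.
have [v vV] : exists v : nat -> set X, range v = A0 |` \bigcup_m V m.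
  apply: countable_range; last by exists A0; left.
  rewrite (_ : _ |` _ = \bigcup_k (if k is m.+1 then V m else [set A0])).
    by apply: bigcup_countable => // -[|m] _ //; have [] := VP m.
  rewrite eqEsubset; split=> [A [->|[m _ VA]]|A [[|m] _ VA]].
  - by exists 0%N.
  - by exists m.+1.
  - by left.
  - by right; exists m.
exists v; split=> [k|s].
  have : range v (v k) by exists k.
  by rewrite vV => -[->//|[m _]]; have [+ _ _] := VP m; apply.
case: s => [|a s].
  by exists 0%N.
have [_ _ /(_ (fun i => nth a (a :: s) i))[A VA sA]] := VP (size s).
have [k _ vk] : range v A by rewrite vV; right; exists (size s).
exists k; rewrite vk => x /= /(nthP a)[i si <-].
exact: (sA (Ordinal si)).
Qed.

(** * The gamma property and function spaces *)

Section gamma_function_spaces.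
Local Open Scope ring_scope.
Variable R : realType.

Lemma omega_family_cozero (X : topologicalType) (U : set (set X)) :
  tychonoff_space X -> lindelof_powers X -> omega_family U ->
  exists h : nat -> X -> R, [/\ forall k, continuous (h k),
    forall k x, 0 <= h k x <= 1,
    forall k, exists2 A, U A & [set x | h k x != 0] `<=` A &
    forall s : seq X, exists k, forall x, x \in s -> h k x != 0].
Proof.
move=> Xtych lX [oU Uf].
pose V := [set B | exists h : X -> R, [/\ continuous h, forall x, 0 <= h x <= 1,
  B = [set x | h x != 0] & exists2 A, U A & B `<=` A]].
have [|v [vV vs]] := @omega_family_countable X V lX.
  split=> [B [h [ch _ -> _]]|s].
    rewrite (_ : [set x | _] = h @^-1` (~` [set 0])).
      apply: open_comp; first by move=> x _; exact: ch.
      by rewrite openC; exact: closed_eq.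
    by rewrite eqEsubset; split=> x /= /eqP.
  have [A UA sA] := Uf s.
  have [u [cu u01 us uA]] := tychonoff_finite_separation R Xtych (oU _ UA) sA.
  exists [set x | 1 - u x != 0]; last first.
    by move=> x xs /=; rewrite us// subr0 oner_neq0.
  exists (fun x => 1 - u x); split => //.
  - by move=> x; apply: cvgB; [exact: cvg_cst|exact: cu].
  - by move=> x; have := u01 x; lra.
  - exists A => // x /= ux; apply: contrapT => /uA ux1.
    by rewrite ux1 subrr eqxx in ux.
have /choice[h hP] := vV.
exists h; split=> [k|k|k|s].
- by have [] := hP k.
- by have [] := hP k.
- by have [_ _ <-] := hP k.
- have [k vk] := vs s; exists k => x /vk; have [_ _ -> _] := hP k; exact.
Qed.

(** The functions [1 + e j * h k] are dense because on a finite set where [h k]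
    has no zero the factor [e j] can be chosen freely.  Off the member of
    [U] that contains the cozero set of [h k] the value is 1, so a sequence of
    these functions tending to 0 at [x] has [x] eventually in those members. *)
Lemma strongly_sequentially_separable_omega_gamma (X : topologicalType) :
  tychonoff_space X -> lindelof_powers X ->
  strongly_sequentially_separable (Cp X R) -> omega_gamma X.
Proof.
move=> Xtych lX [/(dense_sequence_Cp R Xtych)[e [ce de]] sD] U oU.
have [h [ch h01 hU hs]] := omega_family_cozero Xtych lX oU.
have cd (jk : nat * nat) : continuous (fun x => 1 + e jk.1 x * h jk.2 x).
  move=> x; apply: cvgD; first exact: cvg_cst.
  by apply: cvgM; [exact: ce|exact: ch].
pose D := range (fun jk => mkcts (cd jk) : Cp X R).
have cD : countable D by exact: sub_countable (card_image_le _ _) _.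
have dD : dense D.
  apply/(coordinates_dense (@Cp_coordinates R X)) => f s eps eps0.
  have [k hk] := hs s.
  have [j ej] :=
    de (fun x => ((f : continuousType X R) x - 1) / h k x) s eps eps0.
  exists (mkcts (cd (j, k)) : Cp X R); first by exists (j, k).
  move=> x xs; rewrite /= /mkcts /=.
  have -> : 1 + e j x * h k x - (f : continuousType X R) x =
      (e j x - ((f : continuousType X R) x - 1) / h k x) * h k x.
    by field; exact: hk.
  rewrite normrM; apply: le_lt_trans (ej x xs).
  have /andP[hk0 hk1] := h01 k x.
  by rewrite ler_piMr// ger0_norm.
have [d Dd d0] := sD D cD dD (cst 0 : continuousType X R).
have /choice[b bP] i : exists A, U A /\
    forall x, ~ A x -> (d i : continuousType X R) x = 1.
  have [[j k] _ <-] := Dd i; have [A UA hA] := hU k.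
  exists A; split=> // x Ax; rewrite /= /mkcts /=.
  have -> : h k x = 0 by apply/eqP; apply: contrapT => /negP hx; exact/Ax/hA.
  by rewrite mulr0 addr0.
exists b => [i|x]; first by have [] := bP i.
have /cvgrPdist_lt/(_ 1 ltr01) :
    (d i : continuousType X R) x @[i --> \oo] --> (0 : R).
  exact: ((@Cp_coordinates R X) _ _ _).1 d0 x.
apply: filterS => i /=; rewrite sub0r normrN => dix.
apply: contrapT => /(bP i).2.
by move=> di; rewrite di normr1 ltxx in dix.
Qed.

(** Interleaving the [h k] with [g] keeps the sequence separating and makes the
    cozero sets of the [h k] open in the condensation. *)
Lemma projective_omega_gamma (X : topologicalType) (g : nat -> X -> R) :
  tychonoff_space X -> lindelof_powers X -> separating_sequence g ->
  projective_S1_Omega_Gamma X -> omega_gamma X.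
Proof.
move=> Xtych lX [cg gI] pX U oU.
have [h [ch _ hU hs]] := omega_family_cozero Xtych lX oU.
pose f k : X -> R := if odd k then h k./2 else g k./2.
have fS : separating_sequence f.
  split=> [k|x y fxy]; first by rewrite /f; case: odd.
  by apply: gI => k; have := fxy k.*2; rewrite /f odd_double doubleK.
have hf k : h k = f k.*2.+1 by rewrite /f /= odd_double /= uphalf_double.
have /gamma_property_omega_gamma gY : gamma_property (condensation f).
  apply: (pX (condensation f) (idfun : X -> condensation f)).
  - exact: condensation_second_countable.
  - exact: condensation_tychonoff.
  - exact: condensation_continuous fS.1.
  - by rewrite image_id.
have [|b bh bX] := gY (range (fun k => [set x | h k x != 0])).
  split=> [_ [k _ <-]|s].
    rewrite hf (_ : [set x | _] =
        (f k.*2.+1 : condensation f -> R) @^-1` (~` [set 0])).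
      apply: open_comp; first by move=> x _; exact: continuous_on_condensation.
      by rewrite openC; exact: closed_eq.
    by rewrite eqEsubset; split=> x /= /eqP.
  have [k hk] := hs s; exists [set x | h k x != 0]; first by exists k.
  by move=> x; exact: hk.
have /choice[c cP] k : exists A, U A /\ b k `<=` A.
  by have [j _ <-] := bh k; have [A UA hA] := hU j; exists A.
exists c => [k|x]; first by have [] := cP k.
by apply: filterS (bX x) => k; exact: (cP k).2.
Qed.

Lemma omega_gamma_projective (X : topologicalType) :
  omega_gamma X -> projective_S1_Omega_Gamma X.
Proof.
move=> gX Y f _ _ cf fT; apply: omega_gamma_property.
exact: omega_gamma_image gX.
Qed.

Lemma projective_image (X Y : topologicalType) (f : X -> Y) :
  continuous f -> range f = setT ->
  projective_S1_Omega_Gamma X -> projective_S1_Omega_Gamma Y.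
Proof.
move=> cf fT pX Z g Z2 Zt cg gT; apply: (pX Z (g \o f)) => //.
  by move=> x; apply: continuous_comp; [exact: cf|exact: cg].
by rewrite -(image_comp f g) fT.
Qed.

(** [O k a] is the set of points at which [a] is close to [z]; that [z] lies in
    the closure of [A] says that the sets [O k a] with [a] in [A] form an
    omega-family for every [k]. *)
Lemma diagonal_frechet_urysohn (X Z : topologicalType)
    (phi : Z -> nat * X -> R) :
  coordinates phi -> (forall z i, continuous (fun x => phi z (i, x))) ->
  diagonal_omega_gamma X -> frechet_urysohn Z.
Proof.
move=> phiP cphi dX A z /(coordinates_closure phiP) clA.
pose O k a := [set x | forall i : 'I_k,
  `|phi a (val i, x) - phi z (val i, x)| < k.+1%:R^-1].
have [k|b bO bX] := dX (fun k => O k @` A).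
  split=> [_ [a Aa <-]|s].
    rewrite openE => x Ox.
    suff : \forall y \near x, forall i : 'I_k,
      `|phi a (val i, y) - phi z (val i, y)| < k.+1%:R^-1 by [].
    apply: (filter_forall (nbhs_filter x)) => i.
    have : (fun y => `|phi a (val i, y) - phi z (val i, y)|) @ x -->
        `|phi a (val i, x) - phi z (val i, x)|.
      by apply: cvg_norm; apply: cvgB; exact: cphi.
    by move/cvgr_lt; exact.
  have k0 : 0 < k.+1%:R^-1 :> R by rewrite invr_gt0.
  have [a Aa az] := clA [seq (val i, x) | i <- enum 'I_k, x <- s] _ k0.
  exists (O k a); first by exists a.
  move=> x xs i; apply: az; apply/allpairsP; exists (i, x); split=> //.
  by rewrite mem_enum.
have /choice[u uP] k : exists a, A a /\ O k a = b k.
  by have [a Aa Oa] := bO k; exists a.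
exists u => [k|]; first by have [] := uP k.
apply/phiP => -[i x]; apply/cvgrPdist_lt => e e0.
have hx := bX x; have hi := nbhs_infty_gt i.
have he := near_infty_natSinv_lt (PosNum e0).
apply: filterS3 hx hi he => k; rewrite -(uP k).2 => /= kx ik ke.
by rewrite distrC; apply: lt_trans ke; exact: (kx (Ordinal ik)).
Qed.

Section sequences_of_functions.
Variables (X Z : topologicalType) (phi : Z -> nat * X -> R).
Hypotheses (phiP : coordinates phi)
  (phi_surj : forall d : nat -> continuousType X R,
    exists z, forall i x, phi z (i, x) = d i x).

(** Density in a product only involves finitely many entries, so sequences whose
    entries are [d 0] from some index on suffice. *)
Lemma finitary_dense (d : nat -> continuousType X R) :
  dense (range d : set (Cp X R)) ->
  (forall z i, continuous (fun x => phi z (i, x))) ->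
  exists2 D : set Z, countable D & dense D /\
    forall z, D z -> exists k, forall x, phi z (0%N, x) = d k x.
Proof.
move=> /(coordinates_dense (@Cp_coordinates R X)) dd cphi.
have /choice[zs zsP] (l : seq nat) := phi_surj (fun i => d (nth 0%N l i)).
exists (range zs); first exact: sub_countable (card_image_le _ _) _.
split=> [|_ [l _ <-]]; last by exists (nth 0%N l 0); exact: zsP.
apply/(coordinates_dense phiP) => z s eps eps0.
have /choice[l lP] i :
    exists k, close_on (map snd s) eps (d k) (fun x => phi z (i, x)).
  have [_ [k _ <-] dk] := dd (mkcts (cphi z i) : Cp X R) (map snd s) eps eps0.
  by exists k.
have [N sN] : exists N, forall ix, ix \in s -> (ix.1 < N)%N.
  elim: s {lP} => [|ix s [N sN]]; first by exists 0%N.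
  exists (maxn ix.1.+1 N) => jx.
  rewrite in_cons leq_max => /orP[/eqP ->|/sN ->].
    by rewrite leqnn.
  by rewrite orbT.
exists (zs (mkseq l N)); first by exists (mkseq l N).
move=> [i x] ixs; rewrite zsP nth_mkseq; last exact: sN ixs.
by apply: lP; apply/mapP; exists (i, x).
Qed.

Lemma sequences_separable : (forall z i, continuous (fun x => phi z (i, x))) ->
  tychonoff_space X -> separable (Cp X R) -> separable Z.
Proof.
move=> cphi Xtych [D cD dD]; have [|d dE] := countable_range cD.
  have [|f [_ Df]] := dD setT _ openT; last by exists f.
  by exists (cst 0 : continuousType X R).
have [|E cE [dE' _]] := @finitary_dense d _ cphi; first by rewrite dE.
by exists E.
Qed.

End sequences_of_functions.
End gamma_function_spaces.

(** * The equivalences *)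

Section equivalences.
Local Open Scope ring_scope.
Variable R : realType.

Lemma frechet_urysohn_strongly_sequentially_separable (Z : topologicalType) :
  separable Z /\ frechet_urysohn Z -> strongly_sequentially_separable Z.
Proof.
move=> [sZ fuZ]; split=> // D _ /dense_closure dD z; exact: fuZ.
Qed.

(** View a function as a constant sequence and approximate it within the dense
    set of [finitary_dense]; the entries of index 0 give the sequence sought. *)
Lemma sequences_strongly_sequentially_separable (X Z : topologicalType)
    (phi : Z -> nat * X -> R) : coordinates phi ->
  (forall d : nat -> continuousType X R,
    exists z, forall i x, phi z (i, x) = d i x) ->
  (forall z i, continuous (fun x => phi z (i, x))) ->
  strongly_sequentially_separable Z ->
  strongly_sequentially_separable (Cp X R).
Proof.
move=> phiP phi_surj cphi [[D cD /(coordinates_dense phiP) dD] sZ]; split.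
  exists ((fun z => mkcts (cphi z 0%N) : Cp X R) @` D).
    exact: sub_countable (card_image_le _ _) cD.
  apply/(coordinates_dense (@Cp_coordinates R X)) => f s eps eps0.
  have [z zf] := phi_surj (fun=> (f : continuousType X R)).
  have [a Da az] := dD z [seq (0%N, x) | x <- s] eps eps0.
  exists (mkcts (cphi a 0%N) : Cp X R); first by exists a.
  by move=> x xs; rewrite -(zf 0%N); apply: az; exact: map_f.
move=> E cE dE; have [|d rd] := countable_range cE.
  have [|f [_ Ef]] := dE setT _ openT; last by exists f.
  by exists (cst 0 : continuousType X R).
have [|E' cE' [dE' E'd]] := @finitary_dense R X Z phi phiP phi_surj d _ cphi.
  by rewrite rd.
move=> f; have [z zf] := phi_surj (fun=> (f : continuousType X R)).
have [u uE' uz] := sZ E' cE' dE' z.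
have /choice[k kP] j := E'd _ (uE' j).
exists (fun j => d (k j)) => [j|]; first by rewrite -rd; exists (k j).
apply/(@Cp_coordinates R X) => x; rewrite -(zf 0%N).
have uz0 : (fun j => phi (u j) (0%N, x)) @ \oo --> phi z (0%N, x).
  exact: ((phiP _ _ _).1 uz (0%N, x)).
by rewrite (_ : (fun j => _) = (fun j => d (k j) x)) in uz0; last exact/funext.
Qed.

Definition separating_omega_gamma (X : topologicalType) :=
  (exists g : nat -> X -> R, separating_sequence g) /\ omega_gamma X.

Section one_space.
Variable X : topologicalType.
Hypotheses (Xtych : tychonoff_space X) (lX : lindelof_powers X).

Lemma separating_sequence_separable :
  (exists g : nat -> X -> R, separating_sequence g) <-> separable (Cp X R).
Proof.
rewrite -(dense_sequence_Cp R Xtych); split=> [[g]|[e]].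
  exact: separating_sequence_dense.
by exists e; exact: dense_sequence_separating.
Qed.

Lemma strongly_sequentially_separable_Cp :
  strongly_sequentially_separable (Cp X R) -> separating_omega_gamma X.
Proof.
move=> sX; split; last exact: strongly_sequentially_separable_omega_gamma sX.
exact/separating_sequence_separable/sX.1.
Qed.

Lemma separating_omega_gamma_sequences (Z : topologicalType)
    (phi : Z -> nat * X -> R) : coordinates phi ->
  (forall z i, continuous (fun x => phi z (i, x))) ->
  separating_omega_gamma X -> frechet_urysohn Z.
Proof.
move=> phiP cphi [_ gX]; apply: diagonal_frechet_urysohn phiP cphi _.
by apply: omega_gamma_diagonal => //; exact: Xtych.2.
Qed.

Lemma separating_omega_gamma_Cp : separating_omega_gamma X ->
  separable (Cp X R) /\ frechet_urysohn (Cp X R).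
Proof.
move=> sgX; split; first exact/separating_sequence_separable/sgX.1.
apply: (@separating_omega_gamma_sequences (Cp X R)
    (fun f ix => (f : continuousType X R) ix.2)) => //.
  move=> F f FF; rewrite (@Cp_coordinates R X).
  by split=> [fx [i x]//|fx x]; exact: (fx (0%N, x)).
by move=> f i; exact: cts_fun.
Qed.

Lemma Cp_frechet_urysohnP :
  separable (Cp X R) /\ frechet_urysohn (Cp X R) <-> separating_omega_gamma X.
Proof.
split; last exact: separating_omega_gamma_Cp.
move/frechet_urysohn_strongly_sequentially_separable.
exact: strongly_sequentially_separable_Cp.
Qed.

Lemma Cp_strongly_sequentially_separableP :
  strongly_sequentially_separable (Cp X R) <-> separating_omega_gamma X.
Proof.
split; first exact: strongly_sequentially_separable_Cp.
move/separating_omega_gamma_Cp.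
exact: frechet_urysohn_strongly_sequentially_separable.
Qed.

Section sequences.
Variables (Z : topologicalType) (phi : Z -> nat * X -> R).
Hypotheses (phiP : coordinates phi)
  (phi_surj : forall d : nat -> continuousType X R,
    exists z, forall i x, phi z (i, x) = d i x)
  (cphi : forall z i, continuous (fun x => phi z (i, x))).

Lemma sequences_frechet_urysohnP :
  separable Z /\ frechet_urysohn Z <-> separating_omega_gamma X.
Proof.
split=> [/frechet_urysohn_strongly_sequentially_separable|sgX].
  move/(sequences_strongly_sequentially_separable phiP phi_surj cphi).
  exact: strongly_sequentially_separable_Cp.
split; last exact: separating_omega_gamma_sequences phiP cphi sgX.
apply: (sequences_separable phiP phi_surj cphi Xtych).
exact/separating_sequence_separable/sgX.1.
Qed.

Lemma sequences_strongly_sequentially_separableP :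
  strongly_sequentially_separable Z <-> separating_omega_gamma X.
Proof.
split=> [/(sequences_strongly_sequentially_separable phiP phi_surj cphi)|].
  exact: strongly_sequentially_separable_Cp.
move/sequences_frechet_urysohnP.
exact: frechet_urysohn_strongly_sequentially_separable.
Qed.

End sequences.

Lemma iw_S1P :
  iw_eq X [set: nat] /\ S1 (@Omega X) (@Gamma X) <-> separating_omega_gamma X.
Proof.
rewrite -(separating_sequence_iw R); split=> -[sX gX]; split => //.
  exact/gamma_property_omega_gamma/S1_gamma_property.
by apply/diagonal_omega_gamma_S1/omega_gamma_diagonal => //; exact: Xtych.2.
Qed.

Lemma iw_gamma_propertyP :
  iw_eq X [set: nat] /\ gamma_property X <-> separating_omega_gamma X.
Proof.
rewrite -(separating_sequence_iw R); split=> -[sX gX]; split => //.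
  exact: gamma_property_omega_gamma.
exact: omega_gamma_property.
Qed.

Lemma iw_projectiveP :
  iw_eq X [set: nat] /\ projective_S1_Omega_Gamma X <->
  separating_omega_gamma X.
Proof.
rewrite -(separating_sequence_iw R); split=> -[sX gX]; split => //.
  by have [g gS] := sX; exact: (projective_omega_gamma Xtych lX gS gX).
exact: omega_gamma_projective.
Qed.

End one_space.

Lemma separating_omega_gamma_power (X : topologicalType) n : (0 < n)%N ->
  separating_omega_gamma {ptws 'I_n -> X} <-> separating_omega_gamma X.
Proof.
move=> n0; split=> -[[g [cg gI]] gX]; split.
- have cdiag : continuous ((fun x _ => x) : X -> {ptws 'I_n -> X}).
    by apply/continuous_ptws => i x; exact: cvg_id.
  exists (fun k x => g k (fun=> x)); split=> [k x|x y gxy].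
    apply: (@continuous_comp X {ptws 'I_n -> X} R (fun y _ => y) (g k)).
      exact: cdiag.
    exact: cg.
  exact: (congr1 (fun u => u (Ordinal n0)) (gI _ _ gxy)).
- exact: omega_gamma_of_power gX.
- pose i k : 'I_n := nth (Ordinal n0) (enum 'I_n) k.
  exists (fun k u => if unpickle k is Some ki then g ki.1 (u (i ki.2)) else 0).
  split=> [k|u v guv].
    case: unpickle => [ki|] u; last exact: cst_continuous.
    apply: (@continuous_comp {ptws 'I_n -> X} X R); last exact: cg.
    exact: (@proj_continuous _ (fun=> X)).
  apply/funext => j; apply: gI => k.
  have := guv (pickle (k, nat_of_ord j)).
  by rewrite pickleK /i nth_ord_enum.
- exact: omega_gamma_power.
Qed.

End equivalences.

Theorem theorem3p13 (R : realType) (X : topologicalType) (n : nat)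
    (X_tychonoff : tychonoff_space X)
    (powers_lindelof : forall m : nat, (0 < m)%N -> lindelof {ptws 'I_m -> X})
    (n_ge1 : (1 <= n)%N) :
  [<-> (*  1 *) strongly_sequentially_separable (Cp X R);
       (*  2 *) strongly_sequentially_separable (Cp {ptws 'I_n -> X} R);
       (*  3 *) strongly_sequentially_separable {ptws nat -> Cp X R};
       (*  4 *) separable (Cp X R) /\ frechet_urysohn (Cp X R);
       (*  5 *) separable (Cp {ptws 'I_n -> X} R) /\
                frechet_urysohn (Cp {ptws 'I_n -> X} R);
       (*  6 *) separable {ptws nat -> Cp X R} /\
                frechet_urysohn {ptws nat -> Cp X R};
       (*  7 *) iw_eq X [set: nat] /\ projective_S1_Omega_Gamma X;
       (*  8 *) iw_eq X [set: nat] /\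
                projective_S1_Omega_Gamma {ptws 'I_n -> X};
       (*  9 *) iw_eq X [set: nat] /\ S1 (@Omega X) (@Gamma X);
       (* 10 *) iw_eq {ptws 'I_n -> X} [set: nat] /\
                S1 (@Omega {ptws 'I_n -> X}) (@Gamma {ptws 'I_n -> X});
       (* 11 *) iw_eq X [set: nat] /\ gamma_property X;
       (* 12 *) iw_eq {ptws 'I_n -> X} [set: nat] /\
                gamma_property {ptws 'I_n -> X};
       (* 13 *) separable (Cp X {ptws nat -> R}) /\
                frechet_urysohn (Cp X {ptws nat -> R});
       (* 14 *) strongly_sequentially_separable (Cp X {ptws nat -> R})].
Proof.
have Xn_tychonoff := tychonoff_power R n X_tychonoff.
have Xn_lindelof := lindelof_powers_power n_ge1 powers_lindelof.
have XnX := separating_omega_gamma_power R X n_ge1.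
have surj3 (d : nat -> continuousType X R) :
    exists f : {ptws nat -> Cp X R},
      forall i x, (f i : continuousType X R) x = d i x.
  by exists d.
have cts3 (f : {ptws nat -> Cp X R}) i : continuous (f i : continuousType X R).
  exact: cts_fun.
have surj13 (d : nat -> continuousType X R) :
    exists f : Cp X {ptws nat -> R}, forall i x,
      (f : continuousType X {ptws nat -> R}) x i = d i x.
  have cd : continuous ((fun x i => d i x) : X -> {ptws nat -> R}).
    by apply/continuous_ptws => i; exact: cts_fun.
  by exists (@mkcts X {ptws nat -> R} _ cd : continuousType X {ptws nat -> R}).
have cts13 (f : Cp X {ptws nat -> R}) i :
    continuous (fun x => (f : continuousType X {ptws nat -> R}) x i).
  by move: i; apply/continuous_ptws; exact: cts_fun.
have e8 : iw_eq X [set: nat] /\ projective_S1_Omega_Gamma {ptws 'I_n -> X} <->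
    separating_omega_gamma R X.
  rewrite -(iw_projectiveP R X_tychonoff powers_lindelof).
  split=> -[iwX pX]; split => //.
    apply: projective_image pX.
      exact: (@proj_continuous _ (fun=> X) (Ordinal n_ge1)).
    by rewrite eqEsubset; split=> // x _; exists (fun=> x).
  have [_ gX] := (iw_projectiveP R X_tychonoff powers_lindelof).1 (conj iwX pX).
  exact/omega_gamma_projective/omega_gamma_power.
rewrite (propext
  (Cp_strongly_sequentially_separableP R X_tychonoff powers_lindelof)).
rewrite (propext
  (Cp_strongly_sequentially_separableP R Xn_tychonoff Xn_lindelof)).
rewrite (propext (sequences_strongly_sequentially_separableP X_tychonoff
  powers_lindelof (@ptws_Cp_coordinates R X) surj3 cts3)).
rewrite (propext (Cp_frechet_urysohnP R X_tychonoff powers_lindelof)).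
rewrite (propext (Cp_frechet_urysohnP R Xn_tychonoff Xn_lindelof)).
rewrite (propext (sequences_frechet_urysohnP X_tychonoff
  powers_lindelof (@ptws_Cp_coordinates R X) surj3 cts3)).
rewrite (propext (iw_projectiveP R X_tychonoff powers_lindelof)) (propext e8).
rewrite (propext (iw_S1P R X_tychonoff)) (propext (iw_S1P R Xn_tychonoff)).
rewrite (propext (iw_gamma_propertyP R X)).
rewrite (propext (iw_gamma_propertyP R {ptws 'I_n -> X})).
rewrite (propext (sequences_frechet_urysohnP X_tychonoff
  powers_lindelof (@Cp_ptws_coordinates R X) surj13 cts13)).
rewrite (propext (sequences_strongly_sequentially_separableP X_tychonoff
  powers_lindelof (@Cp_ptws_coordinates R X) surj13 cts13)).
by rewrite (propext XnX); tfae.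
Qed.
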